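(* Let $(A,P_A)$, $(B,P_B)$, $(C,P_C)$ be finite strict posets. Then $$\#\{f\in\mathrm{Mor}(P_A,P_B):(f(A),P_B\cap(f(A)\times f(A)))\cong(C,P_C)\}=\frac{|\mathrm{Epi}(P_A,P_C)|\cdot|\mathrm{RegMono}(P_C,P_B)|}{|\mathrm{Aut}(P_C)|},$$ and $$\#\{f\in\mathrm{Mor}(P_A,P_B):(f(A),\mathrm{Tr}(f(P_A)))\cong(C,P_C)\}=\frac{|\mathrm{RegEpi}(P_A,P_C)|\cdot|\mathrm{Mono}(P_C,P_B)|}{|\mathrm{Aut}(P_C)|}.$$
   Context: $\mathsf{PoSet}$ is the category whose objects are finite sets with a strict partial order (asymmetric, transitive relation) and whose morphisms are strictly order-preserving maps ($(a,a')\in P_A\Rightarrow(f(a),f(a'))\in P_B$). $\mathrm{Mor},\mathrm{Mono},\mathrm{Epi},\mathrm{Aut}$ denote morphisms, monomorphisms, epimorphisms, automorphisms in this category; $\mathrm{RegMono}$ regular monomorphisms (equalizers of some parallel pair), $\mathrm{RegEpi}$ regular epimorphisms (coequalizers of some parallel pair). $f(P_A)=\{(f(a),f(a')):(a,a')\in P_A\}$ and $\mathrm{Tr}$ denotes transitive closure. *)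

(* Defs.v *)
From Stdlib Require Import Relation_Operators.
From HB Require Import structures.
From mathcomp Require Import all_boot all_order all_algebra.
From mathcomp Require Import boolp.

Set Implicit Arguments.
Unset Strict Implicit.
Unset Printing Implicit Defensive.

Record sposet := SPoset {
  carrier :> finType;
  slt : rel carrier;
  slt_asym : forall x y, slt x y -> ~~ slt y x;
  slt_trans : transitive slt
}.

Definition strictly_monotone (A B : sposet) (f : {ffun A -> B}) : bool :=
  [forall x : A, forall y : A, slt x y ==> slt (f x) (f y)].

Record Mor (A B : sposet) := MkMor {
  mor_ffun :> {ffun A -> B};
  mor_monotone : strictly_monotone mor_ffun
}.

HB.instance Definition _ (A B : sposet) := [isSub for @mor_ffun A B].
HB.instance Definition _ (A B : sposet) := [Finite of Mor A B by <:].

Lemma morP (A B : sposet) (f : Mor A B) (x y : A) :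
  slt x y -> slt (f x) (f y).
Proof. by move: (mor_monotone f) => /forallP /(_ x) /forallP /(_ y) /implyP; apply. Qed.

Lemma idm_subproof (A : sposet) : @strictly_monotone A A [ffun x => x].
Proof. by apply/forallP=> x; apply/forallP=> y; rewrite !ffunE; apply/implyP. Qed.

Definition idm (A : sposet) : Mor A A := MkMor (idm_subproof A).

Lemma compm_subproof (A B C : sposet) (g : Mor B C) (f : Mor A B) :
  @strictly_monotone A C [ffun x => g (f x)].
Proof.
apply/forallP=> x; apply/forallP=> y; rewrite !ffunE; apply/implyP=> xy.
by apply: morP; apply: morP.
Qed.

Definition compm (A B C : sposet) (g : Mor B C) (f : Mor A B) : Mor A C :=
  MkMor (compm_subproof g f).

Definition is_iso (A B : sposet) (f : Mor A B) : Prop :=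
  exists g : Mor B A, compm g f = idm A /\ compm f g = idm B.

Definition isomorphic (A B : sposet) : Prop := exists f : Mor A B, is_iso f.

Definition is_mono (A B : sposet) (f : Mor A B) : Prop :=
  forall (X : sposet) (g h : Mor X A), compm f g = compm f h -> g = h.

Definition is_epi (A B : sposet) (f : Mor A B) : Prop :=
  forall (X : sposet) (g h : Mor B X), compm g f = compm h f -> g = h.

Definition is_equalizer (E A B : sposet) (e : Mor E A) (u v : Mor A B) : Prop :=
  compm u e = compm v e /\
  forall (X : sposet) (k : Mor X A), compm u k = compm v k ->
    exists! m : Mor X E, compm e m = k.

Definition is_coequalizer (A B Q : sposet) (q : Mor B Q) (u v : Mor A B) : Prop :=
  compm q u = compm q v /\
  forall (X : sposet) (k : Mor B X), compm k u = compm k v ->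
    exists! m : Mor Q X, compm m q = k.

Definition is_regmono (A B : sposet) (f : Mor A B) : Prop :=
  exists (D : sposet) (u v : Mor B D), is_equalizer f u v.

Definition is_regepi (A B : sposet) (f : Mor A B) : Prop :=
  exists (D : sposet) (u v : Mor D A), is_coequalizer f u v.

Definition Mono (A B : sposet) : {set Mor A B} := [set f | `[< is_mono f >]].
Definition Epi (A B : sposet) : {set Mor A B} := [set f | `[< is_epi f >]].
Definition RegMono (A B : sposet) : {set Mor A B} :=
  [set f | `[< is_regmono f >]].
Definition RegEpi (A B : sposet) : {set Mor A B} :=
  [set f | `[< is_regepi f >]].
Definition Aut (A : sposet) : {set Mor A A} := [set f | `[< is_iso f >]].

Section Images.
Variables (A B : sposet) (f : Mor A B).

Definition image_type : finType := {y : B | y \in codom f}.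

Definition induced_rel : rel image_type := fun y y' => slt (val y) (val y').

Lemma induced_asym (y y' : image_type) : induced_rel y y' -> ~~ induced_rel y' y.
Proof. exact: slt_asym. Qed.

Lemma induced_trans : transitive induced_rel.
Proof. by move=> y x z; apply: slt_trans. Qed.

Definition image_induced : sposet := SPoset induced_asym induced_trans.

(* The relation f(P_A), viewed on f(A). *)
Definition pushed_rel : rel image_type := fun y y' =>
  [exists a : A, exists a' : A, [&& slt a a', val y == f a & val y' == f a']].

Definition tr_pushed_rel : rel image_type := fun y y' =>
  `[< clos_trans image_type pushed_rel y y' >].

Lemma tr_pushed_slt (y y' : image_type) :
  tr_pushed_rel y y' -> slt (val y) (val y').
Proof.
move/asboolP; elim=> {y y'} [y y'|x y z _ xy _ yz]; last exact: slt_trans xy yz.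
by case/existsP=> a /existsP [a' /and3P [aa' /eqP-> /eqP->]]; apply: morP.
Qed.

Lemma tr_pushed_asym (y y' : image_type) :
  tr_pushed_rel y y' -> ~~ tr_pushed_rel y' y.
Proof.
by move/tr_pushed_slt/slt_asym; apply: contra => /tr_pushed_slt.
Qed.

Lemma tr_pushed_trans : transitive tr_pushed_rel.
Proof.
by move=> y x z /asboolP xy /asboolP yz; apply/asboolP; apply: t_trans xy yz.
Qed.

Definition image_generated : sposet := SPoset tr_pushed_asym tr_pushed_trans.

End Images.

(* Main.v *)
Require Import Defs.
From Stdlib Require Import Relation_Operators.
From mathcomp Require Import all_boot all_order all_algebra.
From mathcomp Require Import boolp.

(** Both identities count through an orthogonal factorization system [(E, M)]
    on a category with finite hom-sets.  A factorization of [f] through [C] as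
    an [E]-morphism followed by an [M]-morphism exists exactly when the image
    of [f] is isomorphic to [C], and any two such factorizations differ by a
    unique automorphism of [C].  Hence composition maps [E(A, C) x M(C, B)]
    onto the morphisms with image [C], and its fibres are torsors under
    [Aut C].

    The two systems are (epi, regular mono), whose image carries the induced
    order, and (regular epi, mono), whose image carries the generated order.
    Apart from the existence of images they are dual to each other. *)

Set Implicit Arguments.
Unset Strict Implicit.
Unset Printing Implicit Defensive.

Import GRing.Theory Num.Theory.

(** * Categories with finite hom-sets *)

Record fincat := FinCat {
  obj :> Type;
  hom : obj -> obj -> finType;
  idc : forall A, hom A A;
  compc : forall A B C, hom B C -> hom A B -> hom A C;
  compcA : forall A B C D (h : hom C D) (g : hom B C) (f : hom A B),
    compc h (compc g f) = compc (compc h g) f;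
  comp1c : forall A B (f : hom A B), compc (idc B) f = f;
  compc1 : forall A B (f : hom A B), compc f (idc A) = f
}.

Declare Scope fincat_scope.
Local Open Scope fincat_scope.
Local Notation "g \o f" := (compc g f) : fincat_scope.

Definition opposite (K : fincat) : fincat :=
  @FinCat K (fun A B => hom B A) (@idc K) (fun _ _ _ g f => f \o g)
    (fun _ _ _ _ h g f => esym (compcA f g h)) (fun _ _ => @compc1 K _ _)
    (fun _ _ => @comp1c K _ _).

Section MorphismClasses.

Variable K : fincat.
Implicit Types A B C D X : K.

Definition monomorphism A B (f : hom A B) : Prop :=
  forall X (g h : hom X A), f \o g = f \o h -> g = h.

Definition epimorphism A B (f : hom A B) : Prop :=
  forall X (g h : hom B X), g \o f = h \o f -> g = h.

Definition isomorphism A B (f : hom A B) : Prop :=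
  exists g : hom B A, g \o f = idc A /\ f \o g = idc B.

Definition isomorphic_obj A B : Prop := exists f : hom A B, isomorphism f.

Definition automorphisms A : {set hom A A} := [set s | `[< isomorphism s >]].

Definition equalizer E A B (e : hom E A) (u v : hom A B) : Prop :=
  u \o e = v \o e /\
  forall X (k : hom X A), u \o k = v \o k -> exists! n : hom X E, e \o n = k.

Definition regular_mono A B (f : hom A B) : Prop :=
  exists D (u v : hom B D), equalizer f u v.

Definition orthogonal A B C D (e : hom A B) (m : hom C D) : Prop :=
  forall (f : hom A C) (g : hom B D), m \o f = g \o e ->
  exists! s : hom B C, s \o e = f /\ m \o s = g.

Lemma card_automorphisms_gt0 A : 0 < #|automorphisms A|.
Proof.
apply/card_gt0P; exists (idc A); rewrite inE; apply/asboolP.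
by exists (idc A); rewrite compc1.
Qed.

Lemma epimorphism_comp A B C (g : hom B C) (f : hom A B) :
  epimorphism g -> epimorphism f -> epimorphism (g \o f).
Proof. by move=> epi_g epi_f X h k; rewrite !compcA => /epi_f/epi_g. Qed.

Lemma isomorphism_epi A B (f : hom A B) : isomorphism f -> epimorphism f.
Proof.
move=> [g [_ fg]] X h k hf_kf.
by rewrite -[h]compc1 -[k]compc1 -fg !compcA hf_kf.
Qed.

Lemma regular_mono_mono A B (f : hom A B) : regular_mono f -> monomorphism f.
Proof.
move=> [D [u [v [ufv univ]]]] X g h fgh.
have /univ[n [_ n_uniq]] : u \o (f \o h) = v \o (f \o h).
  by rewrite !compcA ufv.
by rewrite -(n_uniq g fgh) -(n_uniq h erefl).
Qed.

Lemma regular_mono_comp_iso A B C (g : hom B C) (f : hom A B) :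
  isomorphism f -> regular_mono g -> regular_mono (g \o f).
Proof.
move=> [t [tf ft]] [D [u [v [ugv univ]]]]; exists D, u, v; split.
  by rewrite !compcA ugv.
move=> X k /univ[n [gn n_uniq]]; exists (t \o n); split.
  by rewrite -compcA [f \o _]compcA ft comp1c.
by move=> n'; rewrite -compcA => /n_uniq ->; rewrite compcA tf comp1c.
Qed.

Lemma epi_regular_mono_orthogonal A B C D (e : hom A B) (m : hom C D) :
  epimorphism e -> regular_mono m -> orthogonal e m.
Proof.
move=> epi_e regm f g mf_ge; have mono_m := regular_mono_mono regm.
have [X [u [v [umv univ]]]] := regm.
have /univ[s [ms _]] : u \o g = v \o g.
  by apply: epi_e; rewrite -!compcA -mf_ge !compcA umv.
exists s; split=> [|s' [_ ms']]; last by apply: mono_m; rewrite ms.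
by split=> //; apply: mono_m; rewrite compcA ms.
Qed.

Lemma orthogonal_fix A B C (e : hom A B) (m : hom B C) (s : hom B B) :
  orthogonal e m -> s \o e = e -> m \o s = m -> s = idc B.
Proof.
move=> orth se ms; have [s' [_ s'_uniq]] := orth e m erefl.
by rewrite -(s'_uniq s) // -(s'_uniq (idc B)) // comp1c compc1.
Qed.

End MorphismClasses.

Section Opposite.

Variable K : fincat.
Implicit Types A B C D : K.

Definition regular_epi A B (f : hom A B) : Prop :=
  @regular_mono (opposite K) B A f.

Lemma isomorphism_opposite A B (f : hom A B) :
  isomorphism f -> @isomorphism (opposite K) B A f.
Proof. by move=> [g [gf fg]]; exists g. Qed.

Lemma orthogonal_opposite A B C D (e : hom A B) (m : hom C D) :
  @orthogonal (opposite K) D C B A m e -> orthogonal e m.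
Proof.
move=> orth f g mf_ge; have [s [[ms se] s_uniq]] := orth g f (esym mf_ge).
by exists s; split=> // s' [s'e ms']; apply: s_uniq.
Qed.

End Opposite.

(** * Counting through a factorization system *)

Section FactorizationSystem.

Variables (K : fincat) (E M : forall A B : K, hom A B -> Prop).
Variable im : forall A B : K, hom A B -> K.
Implicit Types A B C D : K.

Definition factorizes A B C (f : hom A B) (e : hom A C) (m : hom C B) : Prop :=
  [/\ E e, M m & m \o e = f].

Definition has_images : Prop :=
  forall A B (f : hom A B),
  exists (e : hom A (im f)) (m : hom (im f) B), factorizes f e m.

Record factorization_system : Prop := FactorizationSystem {
  left_comp_iso : forall A B C (s : hom B C) (e : hom A B),
    isomorphism s -> E e -> E (s \o e);
  right_comp_iso : forall A B C (m : hom B C) (s : hom A B),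
    isomorphism s -> M m -> M (m \o s);
  left_right_orthogonal : forall A B C D (e : hom A B) (m : hom C D),
    E e -> M m -> orthogonal e m;
  im_factorizes : has_images
}.

Hypothesis EM : factorization_system.

Lemma factorizes_comp_iso A B C C' (f : hom A B) (e : hom A C) (m : hom C B)
    (s : hom C C') (t : hom C' C) :
  t \o s = idc C -> s \o t = idc C' ->
  factorizes f e m -> factorizes f (s \o e) (m \o t).
Proof.
move=> ts st [Ee Mm <-]; split.
- by apply: (left_comp_iso EM) => //; exists t.
- by apply: (right_comp_iso EM) => //; exists s.
- by rewrite -compcA [t \o _]compcA ts comp1c.
Qed.

Lemma factorizes_unique A B C C' (f : hom A B) (e : hom A C) (m : hom C B)
    (e' : hom A C') (m' : hom C' B) :
  factorizes f e m -> factorizes f e' m' ->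
  exists s : hom C C', [/\ isomorphism s, s \o e = e' & m' \o s = m].
Proof.
move=> [Ee Mm mef] [Ee' Mm' mef'].
have [s [[se ms] _]] :=
  left_right_orthogonal EM Ee Mm' (etrans mef' (esym mef)).
have [t [[te mt] _]] :=
  left_right_orthogonal EM Ee' Mm (etrans mef (esym mef')).
exists s; split=> //; exists t; split.
- by apply: (orthogonal_fix (left_right_orthogonal EM Ee Mm));
    rewrite -?compcA ?se ?te // compcA mt ms.
- by apply: (orthogonal_fix (left_right_orthogonal EM Ee' Mm'));
    rewrite -?compcA ?te ?se // compcA ms mt.
Qed.

Lemma isomorphic_im A B C (f : hom A B) :
  isomorphic_obj (im f) C <->
  exists (e : hom A C) (m : hom C B), factorizes f e m.
Proof.
have [e [m fac]] := im_factorizes EM f; split=> [[s [t [ts st]]]|].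
  by exists (s \o e), (m \o t); apply: factorizes_comp_iso.
move=> [e' [m' fac']].
by have [s [iso_s _ _]] := factorizes_unique fac fac'; exists s.
Qed.

Lemma card_factorizations A B C (f : hom A B) (e : hom A C) (m : hom C B) :
  factorizes f e m ->
  #|[set p : hom A C * hom C B | `[< factorizes f p.1 p.2 >]]|
  = #|automorphisms C|.
Proof.
move=> fac; have [Ee Mm _] := fac.
have /choice[inv invP] (s : hom C C) :
    exists t, isomorphism s -> t \o s = idc C /\ s \o t = idc C.
  by have [[t ts]|not_iso] := pselect (isomorphism s); [exists t|exists s].
pose act s := (s \o e, m \o inv s).
have act_inj : {in automorphisms C &, injective act}.
  move=> s t; rewrite !inE => /asboolP/invP[sV Vs] /asboolP/invP[tV Vt].
  move=> [st Vst].
  suff inv_st : inv s \o t = idc C.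
    by rewrite -[s]compc1 -inv_st compcA Vs comp1c.
  apply: orthogonal_fix (left_right_orthogonal EM Ee Mm) _ _.
    by rewrite -compcA -st compcA sV comp1c.
  by rewrite compcA Vst -compcA tV compc1.
rewrite -(card_in_imset act_inj); apply: eq_card => -[e' m'].
apply/idP/imsetP => [|[s]]; rewrite !inE => /asboolP.
  move=> /(factorizes_unique fac)[s [iso_s se ms]].
  have [_ sV] := invP s iso_s; exists s; first by rewrite inE; apply/asboolP.
  by rewrite /act se -ms -compcA sV compc1.
by move=> /(invP s)[sV Vs] [-> ->]; apply/asboolP; apply: factorizes_comp_iso.
Qed.

Lemma card_isomorphic_im A B C :
  #|[set f : hom A B | `[< isomorphic_obj (im f) C >]]| * #|automorphisms C|
  = #|[set e : hom A C | `[< E e >]]| * #|[set m : hom C B | `[< M m >]]|.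
Proof.
rewrite -[RHS]cardsX -[RHS]sum1_card.
rewrite (partition_big (fun p => p.2 \o p.1)
  (mem [set f : hom A B | `[< isomorphic_obj (im f) C >]])) /=; last first.
  move=> [e m]; rewrite !inE /= => /andP[/asboolP Ee /asboolP Mm].
  by apply/asboolP/isomorphic_im; exists e, m.
rewrite -sum_nat_const; apply: eq_bigr => f.
rewrite inE => /asboolP/isomorphic_im[e [m fac]].
rewrite -(card_factorizations fac) sum1_card; apply: eq_card => p.
rewrite [RHS]unfold_in !inE.
apply/asboolP/andP => [[Ee Mm <-]|[/andP[/asboolP Ee /asboolP Mm] /eqP]] //.
by split=> //; apply/andP; split; apply/asboolP.
Qed.

Lemma card_isomorphic_im_div (R : numFieldType) A B C :
  (#|[set f : hom A B | `[< isomorphic_obj (im f) C >]]|%:R =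
   #|[set e : hom A C | `[< E e >]]|%:R * #|[set m : hom C B | `[< M m >]]|%:R
   / #|automorphisms C|%:R :> R)%R.
Proof.
rewrite -natrM -card_isomorphic_im natrM mulfK // pnatr_eq0 -lt0n.
exact: card_automorphisms_gt0.
Qed.

End FactorizationSystem.

(** * Epimorphisms with regular monomorphisms, and the dual system *)

Lemma epi_regular_mono_system (K : fincat)
    (im : forall A B : K, hom A B -> K) :
  has_images (@epimorphism K) (@regular_mono K) im ->
  factorization_system (@epimorphism K) (@regular_mono K) im.
Proof.
move=> images; split=> // [A B C s e iso_s epi_e|A B C m s|A B C D e m].
- exact: epimorphism_comp (isomorphism_epi iso_s) epi_e.
- exact: regular_mono_comp_iso.
- exact: epi_regular_mono_orthogonal.
Qed.

Lemma has_images_opposite (K : fincat)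
    (E M : forall A B : K, hom A B -> Prop)
    (im : forall A B : K, hom A B -> K) :
  has_images E M im ->
  @has_images (opposite K) (fun A B => @M B A) (fun A B => @E B A)
    (fun A B => @im B A).
Proof.
by move=> images A B f; have [e [m [Ee Mm mef]]] := images B A f; exists m, e.
Qed.

Lemma factorization_system_opposite (K : fincat)
    (E M : forall A B : K, hom A B -> Prop)
    (im : forall A B : K, hom A B -> K) :
  @factorization_system (opposite K) (fun A B => @M B A) (fun A B => @E B A)
    (fun A B => @im B A) ->
  factorization_system E M im.
Proof.
move=> [m_iso iso_e orth images].
split=> [A B C s e iso_s|A B C m s iso_s|A B C D e m Ee Mm|].
- by apply: iso_e; apply: isomorphism_opposite.
- by apply: m_iso; apply: isomorphism_opposite.
- by apply: orthogonal_opposite; apply: orth.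
- exact: (has_images_opposite images).
Qed.

Lemma regular_epi_mono_system (K : fincat)
    (im : forall A B : K, hom A B -> K) :
  has_images (@regular_epi K) (@monomorphism K) im ->
  factorization_system (@regular_epi K) (@monomorphism K) im.
Proof.
move=> images; apply: factorization_system_opposite.
exact: (@epi_regular_mono_system (opposite K) _ (has_images_opposite images)).
Qed.

(** * The category of finite strict posets *)

Lemma mor_ext (A B : sposet) (f g : Mor A B) : f =1 g -> f = g.
Proof. by move=> fg; apply/val_inj/ffunP. Qed.

Lemma compmE (A B C : sposet) (g : Mor B C) (f : Mor A B) x :
  compm g f x = g (f x).
Proof. by rewrite ffunE. Qed.

Lemma idmE (A : sposet) x : idm A x = x.
Proof. by rewrite ffunE. Qed.

Lemma compmA (A B C D : sposet) (h : Mor C D) (g : Mor B C) (f : Mor A B) :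
  compm h (compm g f) = compm (compm h g) f.
Proof. by apply: mor_ext => x; rewrite !compmE. Qed.

Lemma comp1m (A B : sposet) (f : Mor A B) : compm (idm B) f = f.
Proof. by apply: mor_ext => x; rewrite compmE idmE. Qed.

Lemma compm1 (A B : sposet) (f : Mor A B) : compm f (idm A) = f.
Proof. by apply: mor_ext => x; rewrite compmE idmE. Qed.

(* [is_mono], [is_epi], [is_regmono], [is_regepi] and [is_iso] are convertible
   to the notions above in this category. *)
Definition sposet_fincat : fincat :=
  @FinCat sposet (fun A B => Mor A B) idm compm compmA comp1m compm1.

Lemma mkmor_subproof (A B : sposet) (f : A -> B) :
  (forall x y, slt x y -> slt (f x) (f y)) ->
  strictly_monotone [ffun x => f x].
Proof.
move=> fM; apply/forallP=> x; apply/forallP=> y.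
by rewrite !ffunE; apply/implyP/fM.
Qed.

Definition mkmor (A B : sposet) (f : A -> B)
    (fM : forall x y, slt x y -> slt (f x) (f y)) : Mor A B :=
  MkMor (mkmor_subproof fM).

Lemma mkmorE (A B : sposet) (f : A -> B) fM x : @mkmor A B f fM x = f x.
Proof. by rewrite ffunE. Qed.

Definition relpre_sposet (T : finType) (B : sposet) (h : T -> B) : sposet :=
  @SPoset T (relpre h (@slt B)) (fun x y => @slt_asym B (h x) (h y))
    (fun y x z => @slt_trans B (h y) (h x) (h z)).

Definition discrete_sposet (T : finType) : sposet :=
  @SPoset T (fun _ _ => false) (fun _ _ _ => isT) (fun _ _ _ xy _ => xy).

Lemma discrete_monotone (T : finType) (B : sposet) (f : T -> B) :
  forall x y : discrete_sposet T, slt x y -> slt (f x) (f y).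
Proof. by []. Qed.

Definition discrete_mor (T : finType) (B : sposet) (f : T -> B) :
    Mor (discrete_sposet T) B :=
  mkmor (discrete_monotone f).

Definition pushforward (A : sposet) (B : Type) (f : A -> B) (y y' : B) : Prop :=
  exists a a', [/\ slt a a', f a = y & f a' = y'].

Lemma surj_epi (A B : sposet) (f : Mor A B) :
  (forall y, y \in codom f) -> is_epi f.
Proof.
move=> f_surj X g h gf_hf; apply: mor_ext => y.
by have /codomP[x ->] := f_surj y; rewrite -!compmE gf_hf.
Qed.

Lemma inj_mono (A B : sposet) (f : Mor A B) : injective f -> is_mono f.
Proof.
move=> f_inj X g h fg_fh; apply: mor_ext => x.
by apply: f_inj; rewrite -!compmE fg_fh.
Qed.

Section DoubledPoset.

Variable B : sposet.

Definition double_sposet : sposet := relpre_sposet (@fst B bool).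

Definition double_tag (P : pred B) : Mor B double_sposet :=
  @mkmor B double_sposet (fun b => (b, P b)) (fun _ _ => id).

(* An embedding equalizes the untagged copy of [B] and the copy whose points
   outside the image are tagged. *)
Lemma embedding_regmono (A : sposet) (f : Mor A B) :
  injective f -> (forall x y, slt (f x) (f y) -> slt x y) -> is_regmono f.
Proof.
move=> f_inj f_reflects.
exists double_sposet, (double_tag pred0), (double_tag [predC codom f]).
split; first by apply: mor_ext => x; rewrite !compmE !mkmorE /= codom_f.
move=> X k eq_k.
have k_im x : k x \in codom f.
  move/(congr1 (fun g : Mor X double_sposet => (g x).2)): eq_k.
  by rewrite !compmE !mkmorE => /esym/negbFE.
have nM x y : slt x y -> slt (iinv (k_im x)) (iinv (k_im y)).
  by move=> xy; apply: f_reflects; rewrite !f_iinv; apply: morP.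
have fn : compm f (mkmor nM) = k.
  by apply: mor_ext => x; rewrite compmE mkmorE f_iinv.
by exists (mkmor nM); split=> // n fn'; apply: (inj_mono f_inj); rewrite fn.
Qed.

End DoubledPoset.

Section GeneratedRegEpi.

Variables (A B : sposet) (f : Mor A B).
Hypothesis f_surj : forall y, y \in codom f.
Hypothesis f_gen :
  forall y y' : B, slt y y' -> clos_trans B (pushforward f) y y'.

Lemma generated_monotone (X : sposet) (n : B -> X) :
  (forall a a', slt a a' -> slt (n (f a)) (n (f a'))) ->
  forall y y', slt y y' -> slt (n y) (n y').
Proof.
move=> nfM y y' /f_gen.
elim=> {y y'} [_ _ [a [a' [aa' <- <-]]]|x y z _ xy _ yz].
  exact: nfM.
exact: slt_trans xy yz.
Qed.

(* The discrete order makes both projections of the kernel pair strictly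
   monotone. *)
Lemma generated_surj_regepi : is_regepi f.
Proof.
pose ker : finType := {p : A * A | f p.1 == f p.2}.
pose fst_ker := discrete_mor (fun p : ker => (val p).1).
pose snd_ker := discrete_mor (fun p : ker => (val p).2).
exists (discrete_sposet ker), fst_ker, snd_ker; split.
  by apply: mor_ext => p; rewrite !compmE !mkmorE; apply/eqP/(valP p).
move=> X k eq_k.
have k_ker a a' : f a = f a' -> k a = k a'.
  move/eqP=> fa_fa'; pose p : ker := exist _ (a, a') fa_fa'.
  move/(congr1 (fun g : Mor (discrete_sposet ker) X => g p)): eq_k.
  by rewrite !compmE !mkmorE.
have nE a : k (iinv (f_surj (f a))) = k a by apply: k_ker; rewrite f_iinv.
have nM :
    forall y y', slt y y' -> slt (k (iinv (f_surj y))) (k (iinv (f_surj y'))).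
  by apply: generated_monotone => a a' aa'; rewrite !nE; apply: morP.
have nf : compm (mkmor nM) f = k.
  by apply: mor_ext => a; rewrite compmE mkmorE nE.
by exists (mkmor nM); split=> // n' n'f; apply: (surj_epi f_surj); rewrite nf.
Qed.

End GeneratedRegEpi.

(** * The two image factorizations *)

Section ImageFactorizations.

Variables (A B : sposet) (f : Mor A B).

Definition corestr (x : A) : image_type f := exist _ (f x) (codom_f f x).

Lemma corestr_surj (y : image_type f) : y \in codom corestr.
Proof.
apply/codomP; case: y => y y_im; exists (iinv y_im).
by apply: val_inj; rewrite /= f_iinv.
Qed.

Lemma pushed_relP (y y' : image_type f) :
  reflect (pushforward corestr y y') (pushed_rel y y').
Proof.
apply: (iffP existsP) => [[a /existsP[a' /and3P[aa' /eqP ya /eqP ya']]]|].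
  by exists a, a'; split=> //; apply: val_inj.
move=> [a [a' [aa' <- <-]]]; exists a; apply/existsP; exists a'.
by rewrite aa' /= !eqxx.
Qed.

Lemma image_induced_factorizes :
  exists (e : Mor A (image_induced f)) (m : Mor (image_induced f) B),
    [/\ is_epi e, is_regmono m & compm m e = f].
Proof.
have eM x x' : slt x x' -> @slt (image_induced f) (corestr x) (corestr x').
  exact: morP.
have mM (y y' : image_induced f) : slt y y' -> slt (val y) (val y') by [].
exists (mkmor eM), (mkmor mM); split.
- apply: surj_epi => y; have /codomP[x ->] := corestr_surj y.
  by rewrite -(mkmorE eM) codom_f.
- by apply: embedding_regmono => y y'; rewrite !mkmorE //; apply: val_inj.
- by apply: mor_ext => x; rewrite compmE !mkmorE.
Qed.

Lemma image_generated_factorizes :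
  exists (e : Mor A (image_generated f)) (m : Mor (image_generated f) B),
    [/\ is_regepi e, is_mono m & compm m e = f].
Proof.
have eM x x' : slt x x' -> @slt (image_generated f) (corestr x) (corestr x').
  by move=> xx'; apply/asboolP/t_step/pushed_relP; exists x, x'.
have mM (y y' : image_generated f) : slt y y' -> slt (val y) (val y').
  exact: tr_pushed_slt.
exists (mkmor eM), (mkmor mM); split.
- apply: generated_surj_regepi => [y|y y' /asboolP].
    have /codomP[x ->] := corestr_surj y.
    by rewrite -(mkmorE eM) codom_f.
  elim=> {y y'} [y y' /pushed_relP[a [a' [aa' <- <-]]]|x y z _ xy _ yz].
    by apply: t_step; exists a, a'; rewrite !mkmorE.
  exact: t_trans xy yz.
- by apply: inj_mono => y y'; rewrite !mkmorE; apply: val_inj.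
- by apply: mor_ext => x; rewrite compmE !mkmorE.
Qed.

End ImageFactorizations.

Local Open Scope ring_scope.

Theorem theoremA30 (A B C : sposet) :
  #|[set f : Mor A B | `[< isomorphic (image_induced f) C >]]|%:R
    = #|Epi A C|%:R * #|RegMono C B|%:R / #|Aut C|%:R :> rat
  /\
  #|[set f : Mor A B | `[< isomorphic (image_generated f) C >]]|%:R
    = #|RegEpi A C|%:R * #|Mono C B|%:R / #|Aut C|%:R :> rat.
Proof.
split.
- exact: (card_isomorphic_im_div
    (@epi_regular_mono_system sposet_fincat _ image_induced_factorizes)).
- exact: (card_isomorphic_im_div
    (@regular_epi_mono_system sposet_fincat _ image_generated_factorizes)).
Qed.
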